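(* Let $p>5$ be a prime. Then $$p\sum_{k=1}^{p-1}\frac{(-1)^{k-1}}{k^5\binom{2k}{k}}\equiv\frac{5(1-L_p^2)}{8p^4}-\frac{5}{4p^3}\Bigl(\mathcal{L}_1(\varphi^2)+\mathcal{L}_1(\varphi^{-2})\Bigr)+\frac{3H_{p-1}(1)}{p^3}-\frac{3p}{5}B_{p-5}\pmod{p^2}$$ and $$\sum_{k=1}^{p-1}\frac{(-1)^k\binom{2k}{k}}{k^4}\equiv\frac{5(1-L_p^2)}{4p^4}-\frac{5}{2p^3}\Bigl(\mathcal{L}_1(\varphi^2)+\mathcal{L}_1(\varphi^{-2})\Bigr)+\frac{6H_{p-1}(1)}{p^3}\pmod{p}.$$
   Context: For integers $n\ge 0$ and $a\ge 1$, $H_n(a)=\sum_{k=1}^n \frac{1}{k^a}$. $B_m\in\mathbb{Q}$ are the Bernoulli numbers defined by $\frac{t}{e^t-1}=\sum_{m\ge 0}B_m\frac{t^m}{m!}$. $L_n$ is the $n$th Lucas number: $L_0=2$, $L_1=1$, $L_n=L_{n-1}+L_{n-2}$ for $n>1$. $\varphi=\frac{1+\sqrt5}{2}$ is the golden ratio, and $\mathcal{L}_1(x)=\sum_{k=1}^{p-1}\frac{x^k}{k}$ is the finite $1$-logarithm (depending on $p$); since $\varphi^{2k}+\varphi^{-2k}=L_{2k}$, the sum $\mathcal{L}_1(\varphi^2)+\mathcal{L}_1(\varphi^{-2})$ is the rational number $\sum_{k=1}^{p-1}L_{2k}/k$. For rational numbers $x,y$ (whose denominators may be divisible by $p$), $x\equiv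 y\pmod{p^r}$ means that $x-y$ has $p$-adic valuation at least $r$. *)

(* Defs.v *)
From mathcomp Require Import all_boot all_order all_algebra all_field.
From mathcomp Require Import ring.
Set Implicit Arguments.
Unset Strict Implicit.
Unset Printing Implicit Defensive.
Import Order.TTheory GRing.Theory Num.Theory.
Local Open Scope ring_scope.

Definition harmonic (n a : nat) : rat := \sum_(1 <= k < n.+1) (k%:R ^+ a)^-1.

Fixpoint lucas (n : nat) : nat :=
  if n is n1.+1 then
    if n1 is n2.+1 then (lucas n1 + lucas n2)%N else 1%N
  else 2%N.

(* A function [f : nat -> F] stands for the formal power series
   sum_n (f n) t^n. *)
Definition fps_mul (F : fieldType) (f g : nat -> F) (n : nat) : F :=
  \sum_(i < n.+1) f i * g (n - i)%N.

(* First [n] coefficients of 1 / f, for f 0 != 0: the coefficient g_m (m > 0)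
   is the solution of  sum_(i <= m) g_i f_(m-i) = 0. *)
Fixpoint fps_inv_seq (F : fieldType) (f : nat -> F) (n : nat) : seq F :=
  if n is m.+1 then
    let s := fps_inv_seq f m in
    rcons s (((m == 0%N)%:R - \sum_(i < m) s`_i * f (m - i)%N) / f 0%N)
  else [::].

Definition fps_inv (F : fieldType) (f : nat -> F) (n : nat) : F :=
  (fps_inv_seq f n.+1)`_n.

(* t / (e^t - 1) is the inverse of (e^t - 1) / t = sum_n t^n / (n+1)!;
   [bernoulli_gf] and [bernoulli_uniq] below characterize this sequence by
   the generating function identity. *)
Definition bernoulli (m : nat) : rat :=
  (m`!)%:R * fps_inv (fun n => ((n.+1)`!)%:R^-1) m.

(* The finite 1-logarithm, evaluated in any field. *)
Definition finlog1 (F : fieldType) (p : nat) (x : F) : F :=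
  \sum_(1 <= k < p) x ^+ k / k%:R.

Definition golden : algC := (1 + sqrtC 5) / 2.

(* p-adic valuation of a nonzero rational; the value at 0 is irrelevant. *)
Definition padic_val (p : nat) (x : rat) : int :=
  (logn p `|numq x|)%:Z - (logn p `|denq x|)%:Z.

(* x = y mod p^r for arbitrary rationals x, y; the first disjunct accounts for
   0 having infinite valuation. *)
Definition congr_rat (p r : nat) (x y : rat) : bool :=
  (x == y) || (r%:Z <= padic_val p (x - y)).

Lemma size_fps_inv_seq (F : fieldType) (f : nat -> F) n :
  size (fps_inv_seq f n) = n.
Proof. by elim: n => //= n IHn; rewrite size_rcons IHn. Qed.

Lemma nth_fps_inv_seq (F : fieldType) (f : nat -> F) n i :
  (i < n)%N -> (fps_inv_seq f n)`_i = fps_inv f i.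
Proof.
elim: n => // n IHn; rewrite ltnS leq_eqVlt => /orP[/eqP -> // | lt_in].
by rewrite /= nth_rcons size_fps_inv_seq lt_in IHn.
Qed.

Lemma fps_invE (F : fieldType) (f : nat -> F) n :
  fps_inv f n =
  ((n == 0%N)%:R - \sum_(i < n) fps_inv f i * f (n - i)%N) / f 0%N.
Proof.
rewrite {1}/fps_inv /= nth_rcons size_fps_inv_seq ltnn eqxx.
by congr ((_ - _) / _); apply: eq_bigr => i _; rewrite nth_fps_inv_seq.
Qed.

Lemma fps_mulVf (F : fieldType) (f : nat -> F) n :
  f 0%N != 0 -> fps_mul (fps_inv f) f n = (n == 0%N)%:R.
Proof.
move=> f0; rewrite /fps_mul big_ord_recr /= subnn [fps_inv f n]fps_invE divfK //.
by rewrite addrC subrK.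
Qed.

(* (sum_m B_m t^m / m!) * (e^t - 1) = t *)
Lemma bernoulli_gf n :
  fps_mul (fun m => bernoulli m / (m`!)%:R)
          (fun m => if m is 0 then 0 else (m`!)%:R^-1) n
  = (n == 1%N)%:R.
Proof.
have fact_neq0 m : (m`!)%:R != 0 :> rat by rewrite pnatr_eq0 -lt0n fact_gt0.
case: n => [|n]; first by rewrite /fps_mul big_ord1 mulr0.
rewrite eqSS -(@fps_mulVf _ (fun n => ((n.+1)`!)%:R^-1 : rat)) ?invr_eq0 //.
rewrite /fps_mul big_ord_recr /= subnn mulr0 addr0; apply: eq_bigr => i _.
rewrite subSn; last by rewrite -ltnS.
by rewrite /bernoulli [_ * fps_inv _ _]mulrC mulfK.
Qed.

Lemma bernoulli_uniq (B : nat -> rat) :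
  (forall n, fps_mul (fun m => B m / (m`!)%:R)
                     (fun m => if m is 0 then 0 else (m`!)%:R^-1) n
             = (n == 1%N)%:R) ->
  B =1 bernoulli.
Proof.
move=> BP n; elim/ltn_ind: n => n IHn.
have fact_neq0 m : (m`!)%:R != 0 :> rat by rewrite pnatr_eq0 -lt0n fact_gt0.
have := BP n.+1; rewrite -bernoulli_gf /fps_mul.
rewrite big_ord_recr [RHS]big_ord_recr /= subnn !mulr0 !addr0.
rewrite big_ord_recr [RHS]big_ord_recr /= subSnn [1`!]factE /= !divr1.
under eq_bigr => i _ do rewrite (IHn _ (ltn_ord i)).
by move/addrI/(congr1 (fun x => x * (n`!)%:R)); rewrite !divfK.
Qed.

Lemma lucasE n : (lucas n)%:R = golden ^+ n + (- golden^-1) ^+ n.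
Proof.
have s2 : sqrtC 5 ^+ 2 = 5 :> algC by rewrite sqrtCK.
have gg : golden ^+ 2 = golden + 1.
  have -> : golden ^+ 2 = (1 + 2 * sqrtC 5 + sqrtC 5 ^+ 2) / 4.
    by rewrite /golden; field.
  by rewrite s2 /golden; field.
have g0 : golden != 0.
  apply/eqP => g0; move: gg; rewrite g0 expr0n /= add0r => /esym/eqP.
  by rewrite oner_eq0.
have gV : - golden^-1 = 1 - golden.
  apply: (mulIf g0); rewrite mulNr mulVf // mulrBl mul1r -expr2 gg.
  by rewrite opprD addrA subrr add0r.
set h := - golden^-1 in gV *.
have hh : h ^+ 2 = h + 1.
  have -> : h ^+ 2 = 1 - 2 * golden + golden ^+ 2 by rewrite gV; ring.
  by rewrite gg gV; ring.
elim/ltn_ind: n => -[|[|n]] IHn.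
- by rewrite !expr0.
- by rewrite !expr1 gV addrC subrK.
rewrite [lucas _]/= -/(lucas n.+1) natrD !IHn //.
have rec x : x ^+ 2 = x + 1 -> x ^+ n.+2 = x ^+ n.+1 + x ^+ n.
  by move=> xx; rewrite -addn2 exprD xx mulrDr mulr1 -exprSr.
by rewrite !rec // addrACA.
Qed.

(* The sum of finite logarithms is rational, so that [getCrat] is applied to
   it without loss. *)
Lemma finlog1_golden p :
  finlog1 p (golden ^+ 2) + finlog1 p (golden ^- 2) =
  ratr (\sum_(1 <= k < p) (lucas (2 * k))%:R / k%:R).
Proof.
rewrite /finlog1 -big_split rmorph_sum; apply: eq_bigr => k _ /=.
rewrite rmorphM fmorphV !rmorph_nat lucasE -mulrDl; congr ((_ + _) / _).
  by rewrite exprM.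
by rewrite exprM sqrrN -exprVn.
Qed.

Lemma getCrat_finlog1_golden p :
  getCrat (finlog1 p (golden ^+ 2) + finlog1 p (golden ^- 2)) =
  \sum_(1 <= k < p) (lucas (2 * k))%:R / k%:R.
Proof.
apply: (fmorph_inj (@ratr algC)).
by rewrite finlog1_golden /= getCratK ?Crat_rat.
Qed.

(* Main.v *)
Require Import Defs.
From mathcomp Require Import all_boot all_order all_algebra all_field.
From mathcomp Require Import zify ring lra.
Set Implicit Arguments.
Unset Strict Implicit.
Unset Printing Implicit Defensive.
Import Order.TTheory GRing.Theory Num.Theory.
Local Open Scope ring_scope.

(** Put A_k = (-1)^(k-1) / C(2k,k), Q_k = prod_(j<k) (1 - p^2/j^2) and
    T_k = A_k Q_k / k^3, and let H = H_(p-1)(1) and S = sum_(k<p) L_(2k)/k.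
    The right-hand sides involve L_p^2 to precision p^6, out of reach of a
    term-by-term p-adic expansion; but up to H and a Bernoulli number they are
    exact rational expressions in sum T_k.

    - Even-indexed Lucas numbers are polynomials in the index,
      L_(2n) = 2 + sum_(k<=n) (n/k) C(n+k-1,2k-1), and the binomial at n = p
      equals 2 p k^2 T_k.  As L_p^2 = L_(2p) - 2, both L_p^2 and S (by a
      hockey-stick summation) are combinations of T_k and k T_k.
      In the theorem the k T_k cancel and
        5(1 - L_p^2)/(8p^4) - 5S/(4p^3) = -5/(4p) sum T_k - 5H/(2p^3)
      holds exactly ([lucas_apery_sum]).
    - Koecher's acceleration of sum 1/(n(n^2 - a^2)) has a finite form
      ([finite_koecher]) whose correction term, at a = p and with p - 1 terms,
      collapses to -H/p^2 ([koecher_harmonic]):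
        sum_(n<p) 1/(n(n^2 - p^2))
          = -H/p^2 + sum T_k (5k^2 - p^2) / (2(k^2 - p^2)).
      Eliminating sum T_k between the two identities, the difference of the
      sides of the first congruence becomes
        p sum_k (A_k/k^3) (1/k^2 - Q_k/(k^2 - p^2))
          + (1/2p) (sum_n 1/(n(n^2 - p^2)) + (6/5) p^2 B_(p-5)).
      The first term vanishes mod p^2 since p A_k is p-integral and Q_k = 1
      mod p^2.
    - For the second term, pairing n with p - n gives
      sum_n 1/(n(n^2 - p^2)) = -(3/2) p H_(p-1)(4) mod p^3, and
      H_(p-1)(4) = (4/5) p B_(p-5) mod p^2.  The latter follows without Kummer's
      congruence: Newton's identities and the roots of
      (X-1)(X-2)...(X-p+1) relate H_(p-1)(4) to sum_(k<p) k^(p-5)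
      ([invpowsum4_powsum]), which Faulhaber's formula evaluates.

    The second right-hand side is twice the first up to a multiple of p, so the
    second congruence reduces to the first by the substitution k -> p - k, under
    which p / C(2(p-j),p-j) = -j C(2j,j)/2 mod p ([central_bin_reflect]). *)

(** * Divisibility of rationals by powers of a prime *)

(** The ideal generated by p^r in the localization of the integers at p; r = 0
    is p-integrality.  The fraction is not required to be reduced, so that
    the ring operations need no normalization. *)
Definition pdvd (p r : nat) (x : rat) : Prop :=
  exists n : int, exists2 d : nat, ~~ (p %| d)%N & x = p%:R ^+ r * n%:~R / d%:R.

Section PrimePowers.
Variable p : nat.
Hypothesis p_pr : prime p.

Lemma natr_ndvd_neq0 d : ~~ (p %| d)%N -> d%:R != 0 :> rat.
Proof. by case: d => [|d]; rewrite ?dvdn0 // pnatr_eq0. Qed.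

Lemma prime_natr_neq0 : p%:R != 0 :> rat.
Proof. by rewrite pnatr_eq0 -lt0n prime_gt0. Qed.

Lemma pdvd0 r : pdvd p r 0.
Proof.
exists 0, 1%N; first by rewrite dvdn1 neq_ltn prime_gt1 ?orbT.
by rewrite mulr0 mul0r.
Qed.

Lemma pdvdN r x : pdvd p r x -> pdvd p r (- x).
Proof.
move=> [n [d pd ->]]; exists (- n), d => //.
by rewrite rmorphN; field; exact: natr_ndvd_neq0.
Qed.

Lemma pdvdD r x y : pdvd p r x -> pdvd p r y -> pdvd p r (x + y).
Proof.
move=> [n [d pd ->]] [m [e pe ->]]; exists (n * e%:Z + m * d%:Z), (d * e)%N.
  by rewrite Euclid_dvdM // negb_or pd.
rewrite natrM rmorphD !rmorphM /= -!pmulrn.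
by field; rewrite !natr_ndvd_neq0.
Qed.

Lemma pdvdB r x y : pdvd p r x -> pdvd p r y -> pdvd p r (x - y).
Proof. by move=> px py; apply: pdvdD => //; apply: pdvdN. Qed.

Lemma pdvdM r s x y : pdvd p r x -> pdvd p s y -> pdvd p (r + s) (x * y).
Proof.
move=> [n [d pd ->]] [m [e pe ->]]; exists (n * m), (d * e)%N.
  by rewrite Euclid_dvdM // negb_or pd.
rewrite natrM !rmorphM /= exprD.
by field; rewrite !natr_ndvd_neq0.
Qed.

Lemma pdvdMl r x y : pdvd p 0 x -> pdvd p r y -> pdvd p r (x * y).
Proof. exact: (@pdvdM 0). Qed.

Lemma pdvdMr r x y : pdvd p r x -> pdvd p 0 y -> pdvd p r (x * y).
Proof. by move=> px py; rewrite mulrC; apply: pdvdMl. Qed.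

Lemma pdvd_le r s x : (s <= r)%N -> pdvd p r x -> pdvd p s x.
Proof.
move=> le_sr [n [d pd ->]]; exists ((p ^ (r - s))%N%:Z * n), d => //.
by rewrite rmorphM /= -pmulrn natrX mulrA -exprD subnKC.
Qed.

Lemma pdvd_int n : pdvd p 0 n%:~R.
Proof.
exists n, 1%N; first by rewrite dvdn1 neq_ltn prime_gt1 ?orbT.
by rewrite mul1r divr1.
Qed.

Lemma pdvd_nat n : pdvd p 0 n%:R.
Proof. by rewrite pmulrn; apply: pdvd_int. Qed.

Lemma pdvd_expp r : pdvd p r (p%:R ^+ r).
Proof.
exists 1, 1%N; first by rewrite dvdn1 neq_ltn prime_gt1 ?orbT.
by rewrite mulr1 divr1.
Qed.

Lemma pdvdX x n : pdvd p 0 x -> pdvd p 0 (x ^+ n).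
Proof.
move=> px; elim: n => [|n IHn]; first exact: (pdvd_nat 1).
by rewrite exprS; apply: pdvdMl.
Qed.

Lemma pdvd_sum r (I : Type) (s : seq I) (P : pred I) (F : I -> rat) :
  (forall i, P i -> pdvd p r (F i)) -> pdvd p r (\sum_(i <- s | P i) F i).
Proof. by move=> pF; apply: big_ind => //; [exact: pdvd0 | exact: pdvdD]. Qed.

Lemma pdvd_sum_nat r a b (F : nat -> rat) :
  (forall i, (a <= i < b)%N -> pdvd p r (F i)) ->
  pdvd p r (\sum_(a <= i < b) F i).
Proof.
move=> pF; rewrite big_seq; apply: pdvd_sum => i.
by rewrite mem_index_iota; apply: pF.
Qed.

Lemma pdvd_invn d : ~~ (p %| d)%N -> pdvd p 0 (d%:R^-1).
Proof. by move=> pd; exists 1, d; rewrite // !mul1r. Qed.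

Lemma pdvd_inv_lt d : (0 < d < p)%N -> pdvd p 0 (d%:R^-1).
Proof. by move=> /andP[d0 dp]; apply: pdvd_invn; rewrite gtnNdvd. Qed.

Lemma pdvd_divp r s x : pdvd p (r + s) x -> pdvd p r (x / p%:R ^+ s).
Proof.
move=> [n [d pd ->]]; exists n, d => //; rewrite exprD.
by field; rewrite natr_ndvd_neq0 //= expf_neq0 // prime_natr_neq0.
Qed.

Lemma congr_rat_pdvd r x y : pdvd p r (x - y) -> congr_rat p r x y.
Proof.
rewrite /congr_rat /padic_val -subr_eq0; set z := x - y => -[n [d pd zE]].
have [//|z0 /=] := eqVneq z 0.
have d0 := natr_ndvd_neq0 pd.
have : numq z * d%:Z = (p ^ r)%N%:Z * n * denq z.
  apply/eqP; rewrite -(eqr_int rat) !rmorphM /= -!pmulrn natrX.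
  rewrite -{1}[z]divq_num_den in zE; apply/eqP.
  have dz : (denq z)%:~R != 0 :> rat by rewrite intr_eq0 denq_neq0.
  have -> : (numq z)%:~R = (denq z)%:~R * (p%:R ^+ r * n%:~R / d%:R) :> rat.
    by rewrite -zE mulrC divfK.
  by field.
move=> /(congr1 absz); rewrite !abszM !absz_nat => E.
have n0 : (0 < `|n|)%N.
  rewrite lt0n absz_eq0; apply: contraNneq z0 => n0.
  by rewrite zE n0 mulr0 mul0r.
have q0 : (0 < `|numq z|)%N by rewrite absz_gt0 numq_eq0.
have e0 : (0 < `|denq z|)%N by rewrite absz_gt0 denq_neq0.
have d'0 : (0 < d)%N by case: (d) pd; rewrite ?dvdn0.
have pr0 : (0 < p ^ r)%N by rewrite expn_gt0 prime_gt0.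
have := congr1 (logn p) E; rewrite !lognM ?muln_gt0 ?pr0 ?n0 //.
rewrite pfactorK // [logn p d]lognE (negPf pd) !andbF addn0.
lia.
Qed.
End PrimePowers.

(** * A finite form of Koecher's identity *)

Section Koecher.
Variables (F : numFieldType) (a : F).

Definition apery_prod k : F := \prod_(1 <= j < k) (1 - a ^+ 2 / j%:R ^+ 2).

Definition binprod N k : F := 'C(N + k, k)%:R * 'C(N, k)%:R.

(** The correction term R(N,k) completing the k-th term of Koecher's series to a
    Wilf-Zeilberger pair: it makes the truncation at N an exact identity. *)
Definition koecher_rem N k : F := (-1) ^+ k * apery_prod k / (2 * k%:R ^+ 3 * binprod N k).

Lemma apery_prodS k : (0 < k)%N -> apery_prod k.+1 = apery_prod k * (1 - a ^+ 2 / k%:R ^+ 2).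
Proof. by move=> k0; rewrite /apery_prod big_nat_recr. Qed.

Lemma binprod_neq0 N k : (k <= N)%N -> binprod N k != 0.
Proof. by move=> kN; rewrite mulf_neq0 // pnatr_eq0 -lt0n bin_gt0 // leq_addl. Qed.

Lemma binprod_small N k : (N < k)%N -> binprod N k = 0.
Proof. by move=> Nk; rewrite /binprod (bin_small Nk) mulr0. Qed.

Lemma binprodSr N k :
  binprod N k.+1 * k.+1%:R ^+ 2 = binprod N k * (N + k).+1%:R * (N%:R - k%:R).
Proof.
have := mul_bin_left N k; have := mul_bin_diag (N + k).+1 k.
have [kN|Nk] := leqP k N; last first.
  by rewrite (binprod_small Nk) (binprod_small (leqW Nk)) !mul0r.
move=> /= /(congr1 (fun n => n%:R : F)) + /(congr1 (fun n => n%:R : F)).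
rewrite !natrM natrB // /binprod addnS => E1 E2.
transitivity ((k.+1%:R * 'C((N + k).+1, k.+1)%:R) * (k.+1%:R * 'C(N, k.+1)%:R) : F).
  by ring.
by rewrite -E1 E2; ring.
Qed.

Lemma binprodSl N k : (N.+1%:R - k%:R) * binprod N.+1 k = (N.+1 + k)%:R * binprod N k.
Proof.
have [kN|Nk] := leqP k N.+1; last first.
  by rewrite (binprod_small Nk) (binprod_small (ltnW Nk)) !mulr0.
have := mul_bin_down N.+1 k; have := mul_bin_down (N.+1 + k) k.
move=> /= /(congr1 (fun n => n%:R : F)) + /(congr1 (fun n => n%:R : F)).
rewrite addnK addSn !natrM natrB // /binprod => /= E1 E2.
apply: (@mulfI _ N.+1%:R); first by rewrite pnatr_eq0.
transitivity ((N.+1%:R * 'C((N + k).+1, k)%:R) * ((N.+1%:R - k%:R) * 'C(N.+1, k)%:R) : F).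
  by rewrite addSn; ring.
by rewrite -E1 -E2; ring.
Qed.

(** Since binprod N k = (N+k)! / ((N-k)! k!^2), the difference
    R(N+1,k) - R(N,k) equals, with n = N+1,
    prod_(j<k) (a^2 - j^2) / (n prod_(j<=k) (n^2 - j^2)), and such sums telescope:
    the partial sums are 1/(n(n^2 - a^2)) (1 - prod_(j<=K) (a^2-j^2)/(n^2-j^2)).
    The right-hand side is that product rewritten with [binprod]. *)
Lemma koecher_rem_telescope N K : (K <= N)%N ->
  (forall n, (0 < n <= N.+1)%N -> n%:R ^+ 2 != a ^+ 2) ->
  \sum_(1 <= k < K.+1) (koecher_rem N.+1 k - koecher_rem N k) =
  (N.+1%:R * (N.+1%:R ^+ 2 - a ^+ 2))^-1 *
  (1 - (-1) ^+ K * apery_prod K.+1 * N.+1%:R / ((N.+1%:R - K%:R) * binprod N.+1 K)).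
Proof.
move=> KN na.
have nN : N.+1%:R ^+ 2 - a ^+ 2 != 0 by rewrite subr_eq0 na ?leqnn.
have n1 : N.+1%:R != 0 :> F by rewrite pnatr_eq0.
elim: K KN => [|K IHK] KN.
  rewrite big_geq // /apery_prod big_geq // /binprod !bin0.
  move: nN n1; rewrite subr0; move: (N.+1%:R) => x nN n1.
  by field; rewrite n1 nN.
rewrite big_nat_recr //= IHK ?(ltnW KN) // (apery_prodS (ltn0Sn K)) /koecher_rem.
have NK : N.+1%:R - K%:R != 0 :> F by rewrite subr_eq0 eqr_nat; lia.
have NK1 : N.+1%:R - K.+1%:R != 0 :> F by rewrite subr_eq0 eqr_nat; lia.
have k0 : K.+1%:R != 0 :> F by rewrite pnatr_eq0.
have nk0 : (N.+1 + K.+1)%:R != 0 :> F by rewrite pnatr_eq0.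
have b0 := @binprod_neq0 N.+1 K (leqW (ltnW KN)).
have nk1 : (N.+1 + K).+1%:R != 0 :> F by rewrite pnatr_eq0.
have -> : binprod N.+1 K.+1 =
    binprod N.+1 K * (N.+1 + K).+1%:R * (N.+1%:R - K%:R) / K.+1%:R ^+ 2.
  by rewrite -binprodSr mulfK // expf_neq0.
have -> : binprod N K.+1 = (N.+1%:R - K.+1%:R) *
    (binprod N.+1 K * (N.+1 + K).+1%:R * (N.+1%:R - K%:R) / K.+1%:R ^+ 2) /
    (N.+1 + K.+1)%:R.
  rewrite -binprodSr mulfK ?expf_neq0 // binprodSl.
  by rewrite [(N.+1 + _)%:R * _]mulrC mulfK.
have natS n : n.+1%:R = n%:R + 1 :> F by rewrite natr1.
move: NK NK1 k0 nk0 b0 nk1 nN n1.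
rewrite [(-1) ^+ K.+1]exprS addnS (natS (N.+1 + K)%N) natrD (natS N) (natS K).
move: N%:R K%:R (binprod _ _) (apery_prod _) ((-1) ^+ K).
move=> x y b q s hNK hNK1 hk0 hnk0 hb0 _ hnN hn1.
field.
by rewrite hk0 hNK hnk0 hb0 hNK1 hnN hn1.
Qed.

(** For a = 0 these are the terms of Apery's series for (2/5) zeta(3). *)
Definition apery_term k : F :=
  (-1) ^+ k.-1 * apery_prod k / (k%:R ^+ 3 * 'C(2 * k, k)%:R).

(** Induction on M: the increment of the left-hand side is what
    [koecher_rem_telescope] produces from the change of truncation, and its
    remaining product is absorbed in the new term k = M+1. *)
Lemma finite_koecher M :
  (forall n, (0 < n <= M)%N -> n%:R ^+ 2 != a ^+ 2) ->
  \sum_(1 <= n < M.+1) (n%:R * (n%:R ^+ 2 - a ^+ 2))^-1 =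
  \sum_(1 <= k < M.+1) koecher_rem M k +
  \sum_(1 <= k < M.+1)
    apery_term k * (5 * k%:R ^+ 2 - a ^+ 2) / (2 * (k%:R ^+ 2 - a ^+ 2)).
Proof.
elim: M => [_|M IHM na]; first by rewrite !big_geq // addr0.
have nN : M.+1%:R ^+ 2 - a ^+ 2 != 0 by rewrite subr_eq0 na ?leqnn.
have n1 : M.+1%:R != 0 :> F by rewrite pnatr_eq0.
have := koecher_rem_telescope (leqnn M) na; rewrite sumrB => /eqP.
rewrite subr_eq => /eqP T.
rewrite big_nat_recr //= IHM => [|n /andP[n0 nM]]; last by rewrite na // n0 ltnW.
rewrite [\sum_(1 <= k < M.+2) koecher_rem _ _]big_nat_recr //= T.
rewrite [\sum_(1 <= k < M.+2) (apery_term _ * _ / _)]big_nat_recr //= {T}.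
have -> : M.+1%:R - M%:R = 1 :> F by rewrite -natrB // subSnn.
have b0 : binprod M.+1 M.+1 != 0 by rewrite binprod_neq0.
have bE : 'C(2 * M.+1, M.+1)%:R = binprod M.+1 M.+1 by rewrite /binprod binn mulr1 addnn mul2n.
have -> : binprod M.+1 M = binprod M.+1 M.+1 * M.+1%:R / 2.
  apply: (@mulIf _ (2 * M.+1%:R)); first by rewrite mulf_neq0 ?pnatr_eq0.
  transitivity (binprod M.+1 M * (M.+1 + M).+1%:R * (M.+1%:R - M%:R)).
    by rewrite -natrB // subSnn mulr1 -addnS addnn -mul2n natrM.
  by rewrite -binprodSr; field.
rewrite /koecher_rem /apery_term bE /= [(-1) ^+ M.+1]exprS.
move: (\sum_(_ <= i < _) _) (\sum_(_ <= i < _) _) nN n1 b0 => A B.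
move: M.+1%:R (binprod _ _) (apery_prod _) ((-1) ^+ M) => x b q s nN n1 b0.
by field; rewrite nN n1 b0.
Qed.
End Koecher.

Lemma central_binS k : (k.+1 * 'C(2 * k.+1, k.+1) = 2 * (2 * k).+1 * 'C(2 * k, k))%N.
Proof.
have E1 := mul_bin_diag (2 * k).+2 k; have E2 := mul_bin_diag (2 * k).+1 k.
have E3 : 'C((2 * k).+1, k.+1) = 'C((2 * k).+1, k).
  by rewrite -bin_sub; [congr 'C(_, _); lia | lia].
rewrite /= E3 in E1 E2; rewrite (_ : 2 * k.+1 = (2 * k).+2)%N; last by lia.
by rewrite -E1 -mulnA E2; lia.
Qed.

Section KoecherNat.
Variable n : nat.
Hypothesis n_gt0 : (0 < n)%N.
Let a : rat := n%:R.

(** The reason for taking a = n and n - 1 terms: C(n-1+k,k) C(n-1,k) contains the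
    product prod_(j<=k) (n^2 - j^2), which cancels the one in [koecher_rem]. *)
Lemma binprod_apery_prod k : (k < n)%N ->
  binprod rat n.-1 k = (-1) ^+ k * n%:R / (n + k)%:R * apery_prod a k.+1.
Proof.
elim: k => [|k IHk] kn.
  by rewrite /binprod /apery_prod big_geq // !bin0 addn0; field; rewrite pnatr_eq0 -lt0n.
have k0 : k.+1%:R != 0 :> rat by rewrite pnatr_eq0.
have nk0 : n%:R + k%:R != 0 :> rat by rewrite -natrD pnatr_eq0; lia.
have nk1 : n%:R + (k%:R + 1) != 0 :> rat by rewrite natr1 -natrD pnatr_eq0; lia.
apply: (@mulIf _ (k.+1%:R ^+ 2)); first by rewrite expf_neq0.
rewrite binprodSr (IHk (ltnW kn)) -natrB; last by lia.
rewrite (_ : (n.-1 + k).+1 = n + k)%N; last by lia.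
rewrite (apery_prodS _ (ltn0Sn k)) /a.
rewrite [(-1) ^+ k.+1]exprS (_ : n.-1 - k = n - k.+1)%N; last by lia.
rewrite natrB ?(ltnW kn) // !natrD; move: k0 nk0 nk1; rewrite -!natr1.
by move: n%:R k%:R (apery_prod _ _) ((-1) ^+ k) => x y q s *; field; apply/and3P.
Qed.

Lemma sqr_nat_neq k : (0 < k < n)%N -> k%:R ^+ 2 != a ^+ 2.
Proof.
by move=> /andP[k0 kn]; rewrite -!natrX eqr_nat eqn_exp2r // neq_ltn kn.
Qed.

Lemma apery_prod_neq0 k : (k <= n)%N -> apery_prod a k != 0.
Proof.
move=> kn; rewrite prodf_seq_neq0; apply/allP => j; rewrite mem_index_iota => /andP[j0 jk] /=.
rewrite subr_eq0 eq_sym; apply: contraTneq isT => E.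
have := @sqr_nat_neq j; rewrite j0 (leq_trans jk kn) => /(_ isT)/eqP; case.
by rewrite -[RHS](@divfK _ (j%:R ^+ 2)) ?E ?mul1r // expf_neq0 // pnatr_eq0; lia.
Qed.

(** After that cancellation R(n-1,k) = -1/(2 n k (n-k)), and
    1/(k(n-k)) = (1/k + 1/(n-k))/n. *)
Lemma sum_koecher_rem :
  \sum_(1 <= k < n) koecher_rem a n.-1 k = - harmonic n.-1 1 / n%:R ^+ 2.
Proof.
have -> : \sum_(1 <= k < n) koecher_rem a n.-1 k =
          - (2 * n%:R ^+ 2)^-1 * \sum_(1 <= k < n) (k%:R^-1 + (n - k)%:R^-1).
  rewrite big_distrr /= !big_nat; apply: eq_bigr => k /andP[k0 kn].
  have q0 := apery_prod_neq0 (ltnW kn).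
  rewrite /koecher_rem binprod_apery_prod // apery_prodS // natrB ?(ltnW kn) // natrD.
  have : (-1) ^+ k != 0 :> rat by rewrite expf_neq0.
  have : k%:R != 0 :> rat by rewrite pnatr_eq0 -lt0n.
  have : n%:R != 0 :> rat by rewrite pnatr_eq0 -lt0n.
  have : n%:R - k%:R != 0 :> rat by rewrite subr_eq0 eqr_nat neq_ltn kn orbT.
  have : n%:R + k%:R != 0 :> rat by rewrite -natrD pnatr_eq0 -lt0n ltn_addr.
  move: q0; rewrite /a; move: n%:R k%:R (apery_prod _ _) ((-1) ^+ k).
  move=> x y q s q0 e0 d0 x0 y0 s0.
  have h1 : y ^+ 2 - x ^+ 2 != 0.
    by rewrite subr_sqr -opprB mulf_neq0 ?oppr_eq0 // addrC.
  by field; rewrite ?q0 ?x0 ?y0 ?s0 ?d0 ?e0 ?h1.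
rewrite big_split /= [X in _ + X]big_nat_rev /=.
have -> : \sum_(1 <= k < n) (n - (1 + n - k.+1))%:R^-1 = \sum_(1 <= k < n) k%:R^-1 :> rat.
  rewrite !big_nat; apply: eq_bigr => k /andP[k0 kn].
  by congr (_%:R^-1); lia.
rewrite /harmonic prednK //.
under [in RHS]eq_bigr do rewrite expr1.
have : n%:R != 0 :> rat by rewrite pnatr_eq0 -lt0n.
by move: (\sum_(_ <= _ < _) _) n%:R => A x x0; field.
Qed.

Lemma koecher_harmonic :
  \sum_(1 <= k < n) (k%:R * (k%:R ^+ 2 - a ^+ 2))^-1 =
  - harmonic n.-1 1 / n%:R ^+ 2 +
  \sum_(1 <= k < n)
    apery_term a k * (5 * k%:R ^+ 2 - a ^+ 2) / (2 * (k%:R ^+ 2 - a ^+ 2)).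
Proof.
rewrite -sum_koecher_rem -(prednK n_gt0) /= finite_koecher // => k /andP[k0 kn].
by rewrite sqr_nat_neq // k0; lia.
Qed.

(** Both sides are n prod_(j<k) (n^2 - j^2) times a factor depending only on k:
    this is what makes Lucas numbers expressible by Koecher's terms. *)
Lemma bin_apery_term k : (0 < k <= n)%N ->
  'C(n + k - 1, 2 * k - 1)%:R = 2 * n%:R * k%:R ^+ 2 * apery_term a k.
Proof.
elim: k => // -[_ _|k IHk /andP[_ kn]].
  rewrite addnK /apery_term /apery_prod big_geq // !muln1 subn1 /= !bin1.
  by field.
have {IHk} := IHk (ltnW kn).
have sE : (-1) ^+ k.+1 = - (-1) ^+ k.+1.-1 :> rat by rewrite exprS mulN1r.
move: k.+1 (ltn0Sn k) kn sE => {k} j j_gt0 kn sE IH.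
have E1 := mul_bin_diag (n + j) (2 * j); have E2 := mul_bin_left (n + j - 1) (2 * j - 1).
have E3 := central_binS j.
have c0 : 'C(2 * j, j)%:R != 0 :> rat by rewrite pnatr_eq0 -lt0n bin_gt0; lia.
have c1 : 'C(2 * j.+1, j.+1)%:R != 0 :> rat by rewrite pnatr_eq0 -lt0n bin_gt0; lia.
have j0 : j%:R != 0 :> rat by rewrite pnatr_eq0 -lt0n.
have j1 : j%:R + 1 != 0 :> rat by rewrite natr1 pnatr_eq0.
have j2 : 2 * j%:R + 1 != 0 :> rat by rewrite -natrM natr1 pnatr_eq0.
rewrite (_ : n + j.+1 - 1 = n + j)%N; last by lia.
rewrite (_ : 2 * j.+1 - 1 = (2 * j).+1)%N; last by lia.
rewrite -subn1 in E1.
rewrite (_ : (2 * j - 1).+1 = 2 * j)%N in E2; last by lia.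
rewrite (_ : n + j - 1 - (2 * j - 1) = n - j)%N in E2; last by lia.
move: E1 E2 E3 => /(congr1 (fun n => n%:R : rat)) E1.
move=> /(congr1 (fun n => n%:R : rat)) E2 /(congr1 (fun n => n%:R : rat)).
rewrite !natrM natrD -natr1 natrM in E1.
rewrite !natrM natrB ?(ltnW kn) // IH in E2.
rewrite !natrM -[j.+1%:R]natr1 -[(2 * j).+1%:R]natr1 natrM => E3.
have {}E1 : 'C(n + j, (2 * j).+1)%:R =
    (n%:R + j%:R) * 'C(n + j - 1, 2 * j)%:R / (2 * j%:R + 1) :> rat.
  by rewrite E1 [_ * 'C(_, _)%:R]mulrC mulfK.
have {}E2 : 'C(n + j - 1, 2 * j)%:R =
    (n%:R - j%:R) * (2 * n%:R * j%:R ^+ 2 * apery_term a j) / (2 * j%:R) :> rat.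
  by rewrite -E2 [_ * 'C(_, _)%:R]mulrC mulfK // mulf_neq0.
have {}E3 : 'C(2 * j.+1, j.+1)%:R =
    2 * (2 * j%:R + 1) * 'C(2 * j, j)%:R / (j%:R + 1) :> rat.
  by rewrite -E3 [_ * 'C(_, _)%:R]mulrC mulfK.
rewrite E1 E2 /apery_term E3 apery_prodS // [j.+1.-1]/= sE -[j.+1%:R]natr1 /a.
move: c0 j0 j1 j2.
move: 'C(2 * j, j)%:R n%:R j%:R (apery_prod _ _) ((-1) ^+ j.-1).
move=> c x y q s c0 y0 y1 y2.
by field; rewrite c0 y0 y1 y2.
Qed.
End KoecherNat.

(** * Lucas numbers as sums of central binomial coefficients *)

(** The Fibonacci numbers F_(2n+1) and F_(2n), as sums over shallow diagonals of
    Pascal's triangle; Pascal's rule is the Fibonacci recurrence. *)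
Definition fibodd n := (\sum_(0 <= k < n.+1) 'C(n + k, 2 * k))%N.
Definition fibeven n := (\sum_(1 <= k < n.+1) 'C(n + k - 1, 2 * k - 1))%N.

Lemma fibevenS n : fibeven n.+1 = (fibeven n + fibodd n)%N.
Proof.
rewrite /fibeven /fibodd big_add1 /= [X in _ = (X + _)%N]big_add1 /=.
rewrite -[X in _ = (X + _)%N]addn0.
rewrite -[X in _ = (_ + X + _)%N](_ : 'C(n + n.+1 - 1, 2 * n.+1 - 1) = 0)%N; last first.
  by rewrite bin_small //; lia.
rewrite -(big_nat_recr n 0 (fun k => 'C(n + k.+1 - 1, 2 * k.+1 - 1))) //=.
rewrite -big_split /=; apply: eq_bigr => k _.
rewrite (_ : n.+1 + k.+1 - 1 = (n + k).+1)%N; last by lia.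
rewrite (_ : 2 * k.+1 - 1 = (2 * k).+1)%N; last by lia.
by rewrite binS; congr ('C(_, _) + _)%N; lia.
Qed.

Lemma fiboddS n : fibodd n.+1 = (fibodd n + fibeven n.+1)%N.
Proof.
rewrite /fibeven /fibodd big_nat_recl // muln0 bin0.
rewrite [X in _ = (X + _)%N]big_nat_recl // muln0 bin0 -addnA; congr (_ + _)%N.
rewrite [X in _ = (_ + X)%N]big_add1 /=.
rewrite -[X in _ = (X + _)%N]addn0.
rewrite -[X in _ = (_ + X + _)%N](_ : 'C(n + n.+1, 2 * n.+1) = 0)%N; last first.
  by rewrite bin_small //; lia.
rewrite -(big_nat_recr n 0 (fun k => 'C(n + k.+1, 2 * k.+1))) //=.
rewrite -big_split /=; apply: eq_bigr => k _.
rewrite (_ : n.+1 + k.+1 - 1 = n + k.+1)%N; last by lia.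
rewrite (_ : 2 * k.+1 - 1 = (2 * k).+1)%N; last by lia.
by rewrite (_ : 2 * k.+1 = (2 * k).+2)%N ?addSn ?binS //; lia.
Qed.

Lemma lucas_fib_split n :
  lucas (2 * n).+1 = (fibeven n.+1 + fibeven n)%N /\
  lucas (2 * n).+2 = (fibodd n.+1 + fibodd n)%N.
Proof.
elim: n => [|n [IH1 IH2]].
  by rewrite /fibeven /fibodd !unlock.
have E : lucas (2 * n.+1).+1 = (fibeven n.+2 + fibeven n.+1)%N.
  rewrite (_ : (2 * n.+1).+1 = (2 * n).+3)%N; last by lia.
  rewrite [LHS]/= -/(lucas (2 * n).+2) -/(lucas (2 * n).+1) IH1 IH2.
  by rewrite [in RHS](fibevenS n.+1) [in RHS](fibevenS n); have := fibevenS n; lia.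
split=> //.
rewrite (_ : (2 * n.+1).+2 = (2 * n).+4)%N; last by lia.
rewrite [LHS]/= -/(lucas (2 * n).+3).
rewrite (_ : (2 * n).+3 = (2 * n.+1).+1)%N; last by lia.
by rewrite E -/(lucas (2 * n).+2) IH2; have := fiboddS n.+1; have := fiboddS n; lia.
Qed.

(** L_(2n) = F_(2n+1) + F_(2n-1), and
    C(n+k,2k) + C(n+k-1,2k) = (n/k) C(n+k-1,2k-1). *)
Lemma lucas_even n :
  (lucas (2 * n))%:R =
  2 + \sum_(1 <= k < n.+1) n%:R / k%:R * 'C(n + k - 1, 2 * k - 1)%:R :> rat.
Proof.
case: n => [|n]; first by rewrite big_geq // addr0.
rewrite (_ : 2 * n.+1 = (2 * n).+2)%N; last by lia.
rewrite (lucas_fib_split n).2 natrD /fibodd.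
have -> : (\sum_(0 <= k < n.+1) 'C(n + k, 2 * k) =
           \sum_(0 <= k < n.+2) 'C(n + k, 2 * k))%N.
  by rewrite [RHS]big_nat_recr //= [X in (_ + X)%N]bin_small ?addn0 //; lia.
rewrite -natrD -big_split big_nat_recl // !muln0 !bin0 natrD; congr (_ + _).
rewrite [in RHS]big_add1 /= natr_sum !big_mkord; apply: eq_bigr => -[k /= kn] _.
rewrite natrD; have k0 := ltn0Sn k; move: k.+1 kn k0 => {}k kn k0.
have E1 := mul_bin_diag (n.+1 + k) (2 * k - 1).
have E2 := mul_bin_left (n + k) (2 * k - 1).
rewrite (_ : n + k - (2 * k - 1) = n.+1 - k)%N in E2; last by lia.
rewrite (_ : (2 * k - 1).+1 = 2 * k)%N in E1 E2; last by lia.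
rewrite addSn /= in E1 *; rewrite subn1 /=.
move: E1 E2 => /(congr1 (fun n => n%:R : rat)) E1 /(congr1 (fun n => n%:R : rat)).
rewrite !natrM natrB // => E2.
have kF : k%:R != 0 :> rat by rewrite pnatr_eq0 -lt0n.
have k2 : 2 * k%:R != 0 :> rat by rewrite mulf_neq0.
rewrite !natrM -addSn natrD in E1.
by apply: (mulfI k2); rewrite mulrDr E2 -[2]/(2%:R) -E1; field.
Qed.

(** The factor n of [lucas_even] cancels, and the sums over n of
    C(n+k-1,2k-1) are hockey sticks. *)
Lemma sum_lucas_even m :
  \sum_(1 <= n < m) (lucas (2 * n))%:R / n%:R =
  2 * \sum_(1 <= n < m) n%:R^-1 +
  \sum_(1 <= k < m) 'C(m + k - 1, 2 * k)%:R / k%:R :> rat.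
Proof.
elim: m => [|m IHm]; first by rewrite !big_geq // mulr0 addr0.
have [->|m0] := posnP m; first by rewrite !big_geq // mulr0 addr0.
rewrite big_nat_recr // [\sum_(1 <= n < m.+1) n%:R^-1]big_nat_recr //= IHm lucas_even.
have mF : m%:R != 0 :> rat by rewrite pnatr_eq0 -lt0n.
have -> : \sum_(1 <= k < m) 'C(m + k - 1, 2 * k)%:R / k%:R =
          \sum_(1 <= k < m.+1) 'C(m + k - 1, 2 * k)%:R / k%:R :> rat.
  by rewrite [RHS]big_nat_recr //= [X in X%:R]bin_small ?mul0r ?addr0 //; lia.
rewrite [(2 + _) / _]mulrDl mulr_suml mulrDr.
have -> : \sum_(1 <= k < m.+1) 'C(m.+1 + k - 1, 2 * k)%:R / k%:R =
  \sum_(1 <= k < m.+1) 'C(m + k - 1, 2 * k)%:R / k%:R +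
  \sum_(1 <= k < m.+1) m%:R / k%:R * 'C(m + k - 1, 2 * k - 1)%:R / m%:R :> rat.
  rewrite -big_split !big_nat; apply: eq_bigr => k /andP[k0 km] /=.
  rewrite (_ : m.+1 + k - 1 = (m + k - 1).+1)%N; last by lia.
  rewrite -{1 2}[(2 * k)%N](@prednK _) ?muln_gt0 // binS -subn1 natrD.
  have kF : k%:R != 0 :> rat by rewrite pnatr_eq0 -lt0n.
  by field; rewrite mF kF.
by ring.
Qed.

Lemma lucas_sqr n : odd n -> (lucas n)%:R ^+ 2 + 2 = (lucas (2 * n))%:R :> rat.
Proof.
move=> n_odd; apply: (@fmorph_inj _ _ (@ratr algC)).
rewrite rmorphD rmorphXn /= !ratr_nat !lucasE.
have g0 : golden != 0.
  apply/eqP => g0; have := lucasE 2.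
  by rewrite g0 invr0 oppr0 expr0n addr0 /= => /eqP; rewrite pnatr_eq0.
have hE : golden * - golden^-1 = -1 by rewrite mulrN divff.
have : (golden * - golden^-1) ^+ n = -1 by rewrite hE -signr_odd n_odd.
rewrite exprMn mulnC !exprM; move: (golden ^+ n) (_ ^+ n) => x y xy.
by rewrite -[2]opprK -[- 2]mulN1r -xy; ring.
Qed.

(** By [bin_apery_term] both L_n^2 and the sum of the L_(2k)/k are combinations
    of the sums of t_k and of k t_k, where t_k = apery_term n k; the
    coefficients 5/8 and 5/4 are those for which k t_k disappears. *)
Lemma lucas_apery_sum n : odd n ->
  5 * (1 - (lucas n)%:R ^+ 2) / (8 * n%:R ^+ 4)
  - 5 / (4 * n%:R ^+ 3) * \sum_(1 <= k < n) (lucas (2 * k))%:R / k%:R =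
  - 5 / (4 * n%:R) * \sum_(1 <= k < n) apery_term n%:R k
  - 5 / (2 * n%:R ^+ 3) * harmonic n.-1 1 :> rat.
Proof.
move=> n_odd; have n0 : (0 < n)%N by case: n n_odd.
have nF : n%:R != 0 :> rat by rewrite pnatr_eq0 -lt0n.
rewrite -[_ ^+ 2](addrK 2) lucas_sqr // lucas_even sum_lucas_even /harmonic prednK //.
under [X in _ = _ - _ * X]eq_bigr do rewrite expr1.
rewrite big_nat_recr //= divff // mul1r (_ : 'C(n + n - 1, 2 * n - 1) = 1)%N; last first.
  by rewrite addnn mul2n binn.
have -> : \sum_(1 <= k < n) n%:R / k%:R * 'C(n + k - 1, 2 * k - 1)%:R =
  \sum_(1 <= k < n) 2 * n%:R ^+ 2 * (k%:R * apery_term n%:R k) :> rat.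
  rewrite !big_nat; apply: eq_bigr => k /andP[k0 kn].
  have kF : k%:R != 0 :> rat by rewrite pnatr_eq0 -lt0n.
  have kn' : (0 < k <= n)%N by rewrite k0 ltnW.
  by rewrite (bin_apery_term n0 kn'); field.
have -> : \sum_(1 <= k < n) 'C(n + k - 1, 2 * k)%:R / k%:R =
  n%:R ^+ 2 * \sum_(1 <= k < n) apery_term n%:R k -
  n%:R * \sum_(1 <= k < n) k%:R * apery_term n%:R k :> rat.
  rewrite !mulr_sumr -sumrB !big_nat; apply: eq_bigr => k /andP[k0 kn].
  have kF : k%:R != 0 :> rat by rewrite pnatr_eq0 -lt0n.
  have := mul_bin_left (n + k - 1) (2 * k - 1).
  rewrite (_ : n + k - 1 - (2 * k - 1) = n - k)%N; last by lia.
  rewrite (_ : (2 * k - 1).+1 = 2 * k)%N; last by lia.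
  move=> /(congr1 (fun n => n%:R : rat)).
  have kn' : (0 < k <= n)%N by rewrite k0 ltnW.
  rewrite !natrM natrB ?(ltnW kn) // (bin_apery_term n0 kn') => E.
  have k2 : 2 * k%:R != 0 :> rat by rewrite mulf_neq0.
  apply: (mulfI k2).
  transitivity (2 * k%:R * 'C(n + k - 1, 2 * k)%:R / k%:R : rat); first by field.
  by rewrite E; field.
rewrite -mulr_sumr.
by move: (\sum_(_ <= _ < _) _) (\sum_(_ <= _ < _) _) (\sum_(_ <= _ < _) _) => A B C; field.
Qed.

(** * Newton's identities *)

Section Newton.
Variable F : fieldType.
Implicit Types (s : seq F) (f g : {poly F}).

(** Leibniz' rule in quotient form, which stays valid for repeated roots. *)
Lemma deriv_prod_XsubC s :
  (\prod_(x <- s) ('X - x%:P))^`() =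
  \sum_(y <- s) (\prod_(x <- s) ('X - x%:P)) %/ ('X - y%:P).
Proof.
elim: s => [|a s IHs]; first by rewrite !big_nil -[1]/(1%:P) derivC.
rewrite !big_cons derivM derivXsubC mul1r IHs mulKp ?polyXsubC_eq0 //.
congr (_ + _); rewrite mulr_sumr [LHS]big_seq [RHS]big_seq; apply: eq_bigr => y ys.
by rewrite divp_mulA // dvdp_XsubCl root_prod_XsubC.
Qed.

(** Horner's scheme read from the top: if f = g (X - x) then
    g_i = f_(i+1) + x g_(i+1). *)
Lemma coef_divp_XsubC f x i N : root f x -> (size f <= (i + N).+1)%N ->
  (f %/ ('X - x%:P))`_i = \sum_(l < N) f`_(i + l).+1 * x ^+ l.
Proof.
rewrite -dvdp_XsubCl => fx; set g := f %/ _.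
have fE j : f`_j.+1 = g`_j - x * g`_j.+1.
  by rewrite -(divpK fx) -/g mulrBr coefB coefMX coefMC /= [x * _]mulrC.
have : (size g <= size f - 1)%N by rewrite size_divp ?polyXsubC_eq0 // size_XsubC.
move=> sg sf; have : g`_(i + N) = 0 by rewrite nth_default // (leq_trans sg) // leq_subLR.
have -> : \sum_(l < N) f`_(i + l).+1 * x ^+ l = g`_i - x ^+ N * g`_(i + N).
  elim: N {sf} => [|N IHN]; first by rewrite big_ord0 addn0 mul1r subrr.
  by rewrite big_ord_recr /= IHN fE addnS exprS; ring.
by move=> ->; rewrite mulr0 subr0.
Qed.

(** Newton's identities: compare the coefficients of f' and of the sum of the
    f/(X - x). *)
Lemma newton_prod_XsubC s i N (f := \prod_(x <- s) ('X - x%:P)) :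
  (size s <= i + N)%N ->
  f`_i.+1 *+ i.+1 = \sum_(l < N) f`_(i + l).+1 * \sum_(x <- s) x ^+ l.
Proof.
move=> sN; rewrite -coef_deriv deriv_prod_XsubC coef_sum -/f.
under [RHS]eq_bigr do rewrite mulr_sumr.
rewrite exchange_big /= [LHS]big_seq [RHS]big_seq; apply: eq_bigr => x xs.
by apply: coef_divp_XsubC; rewrite ?root_prod_XsubC // size_prod_XsubC.
Qed.
End Newton.


(** * Power sums and Bernoulli numbers *)

Lemma fact_neq0 n : (n`!)%:R != 0 :> rat.
Proof. by rewrite pnatr_eq0 -lt0n fact_gt0. Qed.

(** The Taylor coefficients of t/(e^t - 1). *)
Definition bern m : rat := bernoulli m / (m`!)%:R.

Lemma sum_bern m : \sum_(j < m.+1) bern j / ((m.+1 - j)`!)%:R = (m == 0)%:R.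
Proof.
have := bernoulli_gf m.+1; rewrite eqSS => <-.
rewrite /fps_mul [RHS]big_ord_recr /= subnn mulr0 addr0.
by apply: eq_bigr => -[j /= jm] _; rewrite subSn.
Qed.

(** Induction on n: expanding (n+1)^r - n^r and exchanging the sums, the
    coefficient of n^i/i! is the left-hand side of [sum_bern] at m - i, which
    selects i = m. *)
Lemma faulhaber n m :
  \sum_(0 <= k < n) k%:R ^+ m / (m`!)%:R =
  \sum_(j < m.+1) bern j * (n%:R ^+ (m.+1 - j) / ((m.+1 - j)`!)%:R).
Proof.
elim: n => [|n IHn].
  rewrite big_geq // big1 // => -[j /= jm] _.
  by rewrite subSn // expr0n /= mul0r mulr0.
rewrite big_nat_recr //= IHn; apply/esym/eqP.
rewrite -subr_eq0 opprD addrA -sumrB subr_eq0; apply/eqP.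
have binE r : n.+1%:R ^+ r / (r`!)%:R - n%:R ^+ r / (r`!)%:R =
    \sum_(i < r) n%:R ^+ i / (i`!)%:R / ((r - i)`!)%:R :> rat.
  rewrite -natr1 [_ + 1]addrC exprDn big_ord_recr /= subnn binn mulr1n expr0 mul1r.
  rewrite mulrDl addrK mulr_suml; apply: eq_bigr => -[i /= ir] _.
  rewrite expr1n mul1r -mulr_natr -(bin_fact (ltnW ir)) !natrM.
  have b0 : 'C(r, i)%:R != 0 :> rat by rewrite pnatr_eq0 -lt0n bin_gt0 ltnW.
  by field; rewrite b0 !fact_neq0.
under eq_bigr => j _ do rewrite -mulrBr binE
  (big_ord_widen m.+1 (fun i => n%:R ^+ i / (i`!)%:R / ((m.+1 - j - i)`!)%:R))
  ?leq_subr // mulr_sumr.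
rewrite (exchange_big_dep xpredT) //=.
transitivity (\sum_(i < m.+1) n%:R ^+ i / (i`!)%:R * ((m - i)%N == 0%N)%:R : rat).
  apply: eq_bigr => -[i /= im] _; rewrite -sum_bern mulr_sumr.
  rewrite (big_ord_widen m.+1 (fun j =>
    n%:R ^+ i / (i`!)%:R * (bern j / (((m - i).+1 - j)`!)%:R))); last by lia.
  apply: eq_big => [[j /= jm]|[j /= jm] ij]; first by lia.
  by rewrite (_ : m.+1 - j - i = (m - i).+1 - j)%N; [ring | lia].
rewrite big_ord_recr /= subnn mulr1 big1 ?add0r // => -[i /= im] _.
by rewrite subn_eq0 leqNgt im mulr0.
Qed.

Section PowerSums.
Variable p : nat.
Hypothesis p_pr : prime p.

Lemma pdvd_inv_fact n : (n < p)%N -> pdvd p 0 ((n`!)%:R^-1).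
Proof.
elim: n => [|n IHn] np; first by rewrite fact0 invr1; apply: (pdvd_nat p_pr 1).
by rewrite factS natrM invfM; apply: pdvdMl => //; [apply: pdvd_inv_lt | apply: IHn; lia].
Qed.

(** The recurrence for [bern n] only has factorials up to (n+1)! in its
    denominators. *)
Lemma pdvd_bern n : (n.+1 < p)%N -> pdvd p 0 (bern n).
Proof.
elim/ltn_ind: n => n IHn np; have := sum_bern n.
rewrite big_ord_recr /= subSnn (factS 0) muln1 divr1 addrC => /eqP.
rewrite eq_sym -subr_eq => /eqP <-.
apply: pdvdB => //; first exact: pdvd_nat.
apply: pdvd_sum => // -[j /= jn] _; apply: pdvdMl => //; first by apply: IHn => //; lia.
by apply: pdvd_inv_fact; lia.
Qed.

Lemma pdvd_bernoulli n : (n.+1 < p)%N -> pdvd p 0 (bernoulli n).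
Proof.
move=> np; rewrite -[bernoulli n](divfK (fact_neq0 n)).
by apply: pdvdMl => //; [exact: pdvd_bern | exact: pdvd_nat].
Qed.

Lemma big_pred_recr a (f : nat -> rat) : (a < p)%N ->
  \sum_(a <= l < p) f l = \sum_(a <= l < p.-1) f l + f p.-1.
Proof.
by move=> ap; rewrite -(prednK (prime_gt0 p_pr)) big_nat_recr //=; lia.
Qed.

Definition powsum m : rat := \sum_(1 <= k < p) k%:R ^+ m.

(** In Faulhaber's formula the term of B_m is p B_m; all others carry p^2. *)
Lemma powsum_bernoulli m : (0 < m)%N -> (m.+1 < p)%N ->
  pdvd p 2 (powsum m - p%:R * bernoulli m).
Proof.
move=> m0 mp; have := faulhaber p m.
rewrite big_ltn ?prime_gt0 // expr0n eqn0Ngt m0 mul0r add0r -mulr_suml.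
move=> /(canRL (divfK (fact_neq0 m))).
rewrite /powsum => ->; rewrite big_ord_recr /= subSnn (factS 0) muln1 expr1 divr1.
rewrite mulrDl /bern.
rewrite (_ : _ / _ * _ * _ = p%:R * bernoulli m); last by field; rewrite fact_neq0.
rewrite addrK; apply: pdvdMr => //; last exact: pdvd_nat.
apply: pdvd_sum => // -[j /= jm] _; apply: pdvdMl => //; first by apply: pdvd_bern => //; lia.
apply: pdvdMr => //; last by apply: pdvd_inv_fact; lia.
by apply: (@pdvd_le _ (m.+1 - j)); [lia | exact: pdvd_expp].
Qed.

Lemma pdvd_powsum m : (0 < m)%N -> (m.+1 < p)%N -> pdvd p 1 (powsum m).
Proof.
move=> m0 mp; rewrite -[powsum m](subrK (p%:R * bernoulli m)); apply: pdvdD => //.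
  by apply: (@pdvd_le _ 2 1) => //; apply: powsum_bernoulli.
by apply: pdvdMr => //; [exact: (pdvd_expp p_pr 1) | exact: pdvd_bernoulli].
Qed.

Lemma powsum0 : powsum 0 = p%:R - 1.
Proof. by rewrite /powsum sumr_const_nat natrB ?prime_gt0. Qed.

(** The polynomial (X-1)(X-2)...(X-p+1), whose coefficients are the signed
    Stirling numbers of the first kind. *)
Definition fallpoly : {poly rat} :=
  \prod_(x <- [seq k%:R | k <- index_iota 1 p]) ('X - x%:P).

Lemma size_fallpoly : size fallpoly = p.
Proof. by rewrite size_prod_XsubC size_map size_iota subn1 prednK ?prime_gt0. Qed.

Lemma lead_fallpoly : fallpoly`_p.-1 = 1.
Proof.
have /monicP := monic_prod_XsubC [seq k%:R : rat | k <- index_iota 1 p] xpredT id.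
by rewrite lead_coefE -/fallpoly size_fallpoly.
Qed.

Lemma pdvd_coef_fallpoly i : pdvd p 0 fallpoly`_i.
Proof.
rewrite /fallpoly; elim: (index_iota 1 p) i => [|k s IHs] i.
  by rewrite big_nil coef1; apply: pdvd_nat.
rewrite big_cons mulrBl coefB coefXM coefCM; apply: pdvdB => //; last first.
  by apply: pdvdMl => //; exact: pdvd_nat.
by case: i => [|i] //=; exact: pdvd0.
Qed.

Lemma newton_fallpoly i :
  fallpoly`_i.+1 * i.+1%:R = \sum_(0 <= l < p.-1 - i) fallpoly`_(i + l).+1 * powsum l.
Proof.
rewrite mulr_natr (@newton_prod_XsubC _ _ _ (p.-1 - i)); last first.
  by rewrite size_map size_iota; lia.
by rewrite big_mkord; apply: eq_bigr => l _; rewrite /fallpoly !big_map.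
Qed.

(** Lagrange's theorem fallpoly = X^(p-1) - 1 mod p.  In Newton's identity all
    power sums vanish mod p except the 0-th one, which is -1 mod p; what remains
    is (l+1) c_l = 0 mod p. *)
Lemma pdvd1_coef_fallpoly l : (0 < l < p.-1)%N -> pdvd p 1 fallpoly`_l.
Proof.
case: l => // i /andP[_ ip]; have := newton_fallpoly i.
rewrite big_ltn; last by lia.
rewrite addn0 powsum0 => E.
have {}E : fallpoly`_i.+1 * i.+2%:R = fallpoly`_i.+1 * p%:R +
    \sum_(1 <= l < p.-1 - i) fallpoly`_(i + l).+1 * powsum l.
  by rewrite -[i.+2%:R]natr1 mulrDr E; ring.
have i0 : i.+2%:R != 0 :> rat by rewrite pnatr_eq0.
rewrite -[fallpoly`__](mulfK i0) E; apply: pdvdMr => //; last by apply: pdvd_inv_lt => //; lia.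
apply: pdvdD => //.
  by apply: pdvdMl => //; [exact: pdvd_coef_fallpoly | exact: (pdvd_expp p_pr 1)].
apply: pdvd_sum_nat => // m mp; apply: pdvdMl => //; first exact: pdvd_coef_fallpoly.
by apply: pdvd_powsum; lia.
Qed.

Lemma sum_fallpoly k : (0 < k < p)%N ->
  \sum_(0 <= l < p) fallpoly`_l * k%:R ^+ l = 0.
Proof.
move=> kp; rewrite big_mkord.
transitivity fallpoly.[k%:R]; first by rewrite horner_coef size_fallpoly.
by apply/rootP; rewrite root_prod_XsubC map_f // mem_index_iota.
Qed.

(** Wilson's theorem: evaluate at the root 1, where only the extreme coefficients
    survive mod p. *)
Lemma pdvd_coef0_fallpoly : pdvd p 1 (fallpoly`_0 + 1).
Proof.
have p1 := prime_gt1 p_pr; have := @sum_fallpoly 1%N; rewrite p1 => /(_ isT).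
rewrite big_ltn 1?ltnW // expr0 mulr1 big_pred_recr //.
rewrite lead_fallpoly expr1n mulr1 [X in _ + X]addrC addrA => /eqP.
rewrite addr_eq0 => /eqP ->.
apply: pdvdN; apply: pdvd_sum_nat => // i ip; rewrite expr1n mulr1.
by apply: pdvd1_coef_fallpoly; lia.
Qed.

(** Summing fallpoly(k)/k^s = 0 over its roots k relates the negative power sums
    to the positive ones. *)
Lemma sum_fallpoly_shift s :
  \sum_(0 <= l < p) fallpoly`_l * \sum_(1 <= k < p) k%:R ^+ l / k%:R ^+ s = 0.
Proof.
under eq_bigr do rewrite mulr_sumr.
rewrite exchange_big_nat /= big_nat big1 // => k kp.
transitivity ((\sum_(0 <= l < p) fallpoly`_l * k%:R ^+ l) / k%:R ^+ s).
  by rewrite mulr_suml; apply: eq_bigr => l _; rewrite mulrA.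
by rewrite sum_fallpoly // mul0r.
Qed.
Definition invpowsum s : rat := \sum_(1 <= k < p) (k%:R ^+ s)^-1.

Lemma sum_exp_div_ge l s : (s <= l)%N ->
  \sum_(1 <= k < p) k%:R ^+ l / k%:R ^+ s = powsum (l - s).
Proof.
move=> sl; rewrite /powsum !big_nat; apply: eq_bigr => k /andP[k0 _].
have kF : k%:R != 0 :> rat by rewrite pnatr_eq0 -lt0n.
by rewrite -{1}(subnK sl) exprD mulfK // expf_neq0.
Qed.

Lemma sum_exp_div_le l s : (l <= s)%N ->
  \sum_(1 <= k < p) k%:R ^+ l / k%:R ^+ s = invpowsum (s - l).
Proof.
move=> sl; rewrite /invpowsum !big_nat; apply: eq_bigr => k /andP[k0 _].
have kF : k%:R != 0 :> rat by rewrite pnatr_eq0 -lt0n.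
by rewrite -{1}(subnK sl) exprD invfM mulrCA divff ?mulr1 // expf_neq0.
Qed.

Lemma pdvd_invexp k s : (0 < k < p)%N -> pdvd p 0 ((k%:R ^+ s)^-1).
Proof. by move=> kp; rewrite -exprVn; apply: pdvdX => //; apply: pdvd_inv_lt. Qed.

(** Modulo p only the extreme coefficients of fallpoly survive in
    [sum_fallpoly_shift], so that c_0 invpowsum s = - powsum (p-1-s). *)
Lemma pdvd_invpowsum s : (0 < s)%N -> (s.+1 < p)%N -> pdvd p 1 (invpowsum s).
Proof.
move=> s0 sp; have := sum_fallpoly_shift s.
rewrite big_ltn; last by lia.
rewrite [X in _ + X = _ -> _]big_pred_recr; last by lia.
rewrite lead_fallpoly mul1r sum_exp_div_le // subn0 sum_exp_div_ge; last by lia.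
set X := \sum_(_ <= _ < _) _; move=> E.
have -> : invpowsum s = (fallpoly`_0 + 1) * invpowsum s + (X + powsum (p.-1 - s)).
  by apply/eqP; rewrite mulrDl -addrA addrCA E mul1r addr0.
apply: pdvdD => //.
  apply: pdvdMr => //; first exact: pdvd_coef0_fallpoly.
  by apply: pdvd_sum_nat => // k kp; apply: pdvd_invexp.
apply: pdvdD => //; last by apply: pdvd_powsum; lia.
apply: pdvd_sum_nat => // l lp; apply: pdvdMr => //; first by apply: pdvd1_coef_fallpoly; lia.
apply: pdvd_sum_nat => // k kp; apply: pdvdMl => //.
  by apply: pdvdX => //; apply: pdvd_nat.
exact: pdvd_invexp.
Qed.

(** Let c_4 be the coefficient of X^4 in fallpoly.  Modulo p^2, every product of
    a middle coefficient and a power sum of nonzero exponent vanishes.  Then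
    [sum_fallpoly_shift] at s = 4 reads
    - invpowsum 4 - c_4 + powsum (p-5) = 0, while Newton's identity for c_4 reads
    5 c_4 = powsum (p-5). *)
Lemma invpowsum4_powsum : (5 < p)%N ->
  pdvd p 2 (5 * invpowsum 4 - 4 * powsum (p - 5)).
Proof.
move=> p5.
have p7 : (6 < p)%N.
  by rewrite ltn_neqAle p5 andbT; apply: contraTneq p_pr => <-.
have := sum_fallpoly_shift 4.
rewrite (@big_cat_nat _ _ _ 4) /=; [|lia|lia].
rewrite big_ltn // [\sum_(4 <= l < p) _]big_ltn; last by lia.
rewrite sum_exp_div_le // sum_exp_div_ge // subnn powsum0.
rewrite [\sum_(5 <= l < p) _]big_pred_recr; last by lia.
rewrite lead_fallpoly mul1r sum_exp_div_ge; last by lia.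
rewrite (_ : p.-1 - 4 = p - 5)%N; last by lia.
set A := \sum_(1 <= _ < 4) _; set B := \sum_(5 <= _ < _) _ => E1.
have := newton_fallpoly 3.
rewrite big_ltn; last by lia.
rewrite (_ : p.-1 - 3 = (p - 5).+1)%N; last by lia.
rewrite big_nat_recr /=; last by lia.
rewrite powsum0 addn0 (_ : (3 + (p - 5)).+1 = p.-1)%N; last by lia.
rewrite lead_fallpoly mul1r; set C := \sum_(1 <= _ < _) _ => E2.
have -> : 5 * invpowsum 4 - 4 * powsum (p - 5) =
   5 * ((fallpoly`_0 + 1) * invpowsum 4) + 5 * A + 5 * B + 4 * (p%:R * fallpoly`_4) - C.
  move: E1 E2; move: A B C (invpowsum 4) (powsum _) fallpoly`_0 fallpoly`_4 p%:R.
  by move=> *; lra.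
have cP := @pdvd_coef_fallpoly; have c1P := @pdvd1_coef_fallpoly.
have nP n := pdvd_nat p_pr n.
have pP : pdvd p 1 p%:R by apply: (pdvd_expp p_pr 1).
apply: pdvdB => //; last first.
  apply: pdvd_sum_nat => // l lp; apply: (@pdvdM _ _ 1 1) => //.
    by apply: c1P; lia.
  by apply: pdvd_powsum; lia.
do 3?[apply: pdvdD => //].
- apply: pdvdMl => //; apply: (@pdvdM _ _ 1 1) => //; first exact: pdvd_coef0_fallpoly.
  by apply: pdvd_invpowsum; lia.
- apply: pdvdMl => //; apply: pdvd_sum_nat => // l lp; apply: (@pdvdM _ _ 1 1) => //.
    by apply: c1P; lia.
  by rewrite sum_exp_div_le; [apply: pdvd_invpowsum; lia | lia].
- apply: pdvdMl => //; apply: pdvd_sum_nat => // l lp; apply: (@pdvdM _ _ 1 1) => //.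
    by apply: c1P; lia.
  by rewrite sum_exp_div_ge; [apply: pdvd_powsum; lia | lia].
apply: pdvdMl => //; apply: (@pdvdM _ _ 1 1) => //.
by apply: c1P; lia.
Qed.

Lemma invpowsum4_bernoulli : (5 < p)%N ->
  pdvd p 2 (5 * invpowsum 4 - 4 * (p%:R * bernoulli (p - 5))).
Proof.
move=> p5; have -> : 5 * invpowsum 4 - 4 * (p%:R * bernoulli (p - 5)) =
  5 * invpowsum 4 - 4 * powsum (p - 5) + 4 * (powsum (p - 5) - p%:R * bernoulli (p - 5)).
  by ring.
apply: pdvdD => //; first exact: invpowsum4_powsum.
by apply: pdvdMl => //; [apply: (pdvd_nat p_pr 4) | apply: powsum_bernoulli; lia].
Qed.

(** With f k = 1/(k(k^2 - p^2)), the sum f k + f (p-k) equals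
    -3p / (k(p-k)(k+p)(2p-k)), and mod p^2 the cofactor of -3p is
    1/k^4 + 2p/k^5. *)
Lemma sum_inv_cubic : (5 < p)%N ->
  pdvd p 3 (\sum_(1 <= k < p) (k%:R * (k%:R ^+ 2 - p%:R ^+ 2))^-1
            + 6 / 5 * (p%:R ^+ 2 * bernoulli (p - 5))).
Proof.
move=> p5; have p2 : (2 < p)%N by lia.
have pP : pdvd p 1 p%:R by apply: (pdvd_expp p_pr 1).
have nP n := pdvd_nat p_pr n.
set f := fun k : nat => (k%:R * (k%:R ^+ 2 - p%:R ^+ 2))^-1 : rat.
have pairE k : (0 < k < p)%N -> f k + f (p - k)%N =
    - (3 * p%:R) * (k%:R * (p%:R - k%:R) * (k%:R + p%:R) * (2 * p%:R - k%:R))^-1.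
  move=> /andP[k0 kp]; rewrite /f natrB ?(ltnW kp) //.
  have kF : k%:R != 0 :> rat by rewrite pnatr_eq0 -lt0n.
  have h1 : p%:R - k%:R != 0 :> rat by rewrite -natrB ?(ltnW kp) // pnatr_eq0; lia.
  have h2 : k%:R + p%:R != 0 :> rat by rewrite -natrD pnatr_eq0; lia.
  have h3 : 2 * p%:R - k%:R != 0 :> rat.
    by rewrite -natrM -natrB ?pnatr_eq0; lia.
  have h4 : k%:R ^+ 2 - p%:R ^+ 2 != 0 :> rat.
    by rewrite subr_sqr mulf_neq0 // -oppr_eq0 opprB.
  have h5 : (p%:R - k%:R) ^+ 2 - p%:R ^+ 2 != 0 :> rat.
    rewrite subr_sqr mulf_neq0 //.
      by rewrite (_ : _ - _ - _ = - k%:R) ?oppr_eq0 //; ring.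
    by rewrite (_ : _ + _ = 2 * p%:R - k%:R) //; ring.
  by field; rewrite ?kF ?h1 ?h2 ?h3 ?h4 ?h5.
have expand k : (0 < k < p)%N -> pdvd p 2
    ((k%:R * (p%:R - k%:R) * (k%:R + p%:R) * (2 * p%:R - k%:R))^-1
     - ((k%:R ^+ 4)^-1 + 2 * p%:R * (k%:R ^+ 5)^-1)).
  move=> kp; have /andP[k0 kp'] := kp.
  set D := _ * _ * _ * _.
  have DE : D = (k * (p - k) * (k + p) * (2 * p - k))%N%:R.
    by rewrite !natrM natrD !natrB ?natrM //; lia.
  have pD : ~~ (p %| k * (p - k) * (k + p) * (2 * p - k))%N.
    have pk : ~~ (p %| k)%N by rewrite gtnNdvd.
    rewrite !Euclid_dvdM // !negb_or pk dvdn_addl // pk dvdn_subr ?pk ?(ltnW kp') ?dvdnn //=.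
    by rewrite dvdn_subr ?pk ?dvdn_mull //; lia.
  have -> : D^-1 - ((k%:R ^+ 4)^-1 + 2 * p%:R * (k%:R ^+ 5)^-1) =
      p%:R ^+ 2 * ((5%:R * k%:R ^+ 2 - 4%:R * p%:R ^+ 2) * (k%:R ^+ 4)^-1 * D^-1) :> rat.
    have D0 : D != 0 by rewrite DE (natr_ndvd_neq0 pD).
    have kF : k%:R != 0 :> rat by rewrite pnatr_eq0 -lt0n.
    apply: (mulIf (mulf_neq0 D0 (expf_neq0 5 kF))).
    transitivity (k%:R ^+ 5 - (k%:R + 2 * p%:R) * D); first by field; rewrite kF D0.
    transitivity (p%:R ^+ 2 * k%:R * (5%:R * k%:R ^+ 2 - 4%:R * p%:R ^+ 2) : rat).
      by rewrite /D; ring.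
    by field; rewrite kF D0.
  apply: pdvdMr => //; first exact: pdvd_expp.
  rewrite DE; apply: pdvdMl => //; last exact: pdvd_invn.
  apply: pdvdMl => //; last exact: pdvd_invexp.
  by apply: pdvdB => //; apply: pdvdMl => //; apply: pdvdX.
set g := fun k : nat => (k%:R * (p%:R - k%:R) * (k%:R + p%:R) * (2 * p%:R - k%:R))^-1 : rat.
have sumE : \sum_(1 <= k < p) f k = - (3 * p%:R) / 2 * \sum_(1 <= k < p) g k.
  have E : \sum_(1 <= k < p) f k + \sum_(1 <= k < p) f k =
      - (3 * p%:R) * \sum_(1 <= k < p) g k.
    rewrite [X in _ + X]big_nat_rev -big_split mulr_sumr !big_nat.
    by apply: eq_bigr => k kp; rewrite /= add1n subSS pairE.
  by move: E; move: (\sum_(_ <= _ < _) _) (\sum_(_ <= _ < _) _) => x y E; lra.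
have sumg : pdvd p 2 (\sum_(1 <= k < p) g k - (invpowsum 4 + 2 * p%:R * invpowsum 5)).
  rewrite /invpowsum mulr_sumr -big_split -sumrB.
  by apply: pdvd_sum_nat => // k kp; apply: expand.
have p7 : (6 < p)%N.
  by rewrite ltn_neqAle p5 andbT; apply: contraTneq p_pr => <-.
have -> : \sum_(1 <= k < p) (k%:R * (k%:R ^+ 2 - p%:R ^+ 2))^-1
      + 6 / 5 * (p%:R ^+ 2 * bernoulli (p - 5))
  = - (3%:R * 2%:R^-1) * (p%:R * (\sum_(1 <= k < p) g k
                               - (invpowsum 4 + 2 * p%:R * invpowsum 5)))
    - 3%:R * (p%:R ^+ 2 * invpowsum 5)
    - 3%:R * 2%:R^-1 * 5%:R^-1 *
        (p%:R * (5 * invpowsum 4 - 4 * (p%:R * bernoulli (p - 5)))).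
  by rewrite -[\sum_(_ <= _ < _) _]/(\sum_(1 <= k < p) f k) sumE; field.
have h2 : pdvd p 0 2%:R^-1 by apply: pdvd_inv_lt; lia.
have h5 : pdvd p 0 5%:R^-1 by apply: pdvd_inv_lt; lia.
apply: pdvdB => //; last first.
  apply: pdvdMl => //; first by do !apply: pdvdMl => //.
  by apply: (@pdvdM _ _ 1 2) => //; apply: invpowsum4_bernoulli.
apply: pdvdB => //; last first.
  apply: pdvdMl => //; apply: (@pdvdM _ _ 2 1) => //; first exact: pdvd_expp.
  by apply: pdvd_invpowsum; lia.
apply: pdvdMl => //; first by apply: pdvdN; apply: pdvdMl.
exact: (@pdvdM _ _ 1 2).
Qed.
End PowerSums.

(** * The two congruences *)

Section Congruences.
Variable p : nat.
Hypothesis p_pr : prime p.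
Hypothesis p_odd : odd p.

Let p_gt2 : (2 < p)%N.
Proof. exact: odd_prime_gt2. Qed.

Lemma pdvd_inv_sub_sqr k : (0 < k < p)%N -> pdvd p 0 ((k%:R ^+ 2 - p%:R ^+ 2)^-1).
Proof.
move=> kp; have /andP[k0 kp'] := kp.
have -> : k%:R ^+ 2 - p%:R ^+ 2 = - ((p - k) * (p + k))%N%:R :> rat.
  by rewrite natrM natrD natrB ?(ltnW kp') //; ring.
rewrite invrN; apply: pdvdN; apply: pdvd_invn.
by rewrite Euclid_dvdM // negb_or dvdn_addr // !gtnNdvd //; lia.
Qed.

(** The inverse is included because [central_bin_reflect] has the product in
    its denominator. *)
Lemma pdvd_apery_prod k : (k <= p)%N ->
  pdvd p 2 (apery_prod p%:R k - 1 : rat) /\ pdvd p 0 ((apery_prod p%:R k)^-1 : rat).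
Proof.
elim: k => [|k IHk] kp.
  rewrite /apery_prod big_geq // subrr invr1; split; first exact: pdvd0.
  exact: (pdvd_nat p_pr 1).
have [->|k0] := posnP k.
  rewrite /apery_prod big_geq // subrr invr1; split; first exact: pdvd0.
  exact: (pdvd_nat p_pr 1).
have [IH1 IH2] := IHk (ltnW kp); rewrite apery_prodS //.
have k0p : (0 < k < p)%N by rewrite k0.
have kF : k%:R != 0 :> rat by rewrite pnatr_eq0 -lt0n.
split.
  have -> : apery_prod p%:R k * (1 - p%:R ^+ 2 / k%:R ^+ 2) - 1 =
    (apery_prod p%:R k - 1)
    - (apery_prod p%:R k - 1 + 1) * (p%:R ^+ 2 / k%:R ^+ 2) :> rat by ring.
  apply: pdvdB => //; apply: pdvdMl => //.
    apply: pdvdD => //; last exact: (pdvd_nat p_pr 1).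
    exact: (@pdvd_le _ 2).
  by apply: pdvdMr => //; [exact: pdvd_expp | exact: pdvd_invexp].
rewrite invfM; apply: pdvdMl => //.
have -> : (1 - p%:R ^+ 2 / k%:R ^+ 2)^-1 = k%:R ^+ 2 * (k%:R ^+ 2 - p%:R ^+ 2)^-1 :> rat.
  rewrite -[X in X - _](@divff _ (k%:R ^+ 2)) ?expf_neq0 // -mulrBl.
  by rewrite invfM invrK mulrC.
apply: pdvdMl => //; last exact: pdvd_inv_sub_sqr.
by apply: pdvdX => //; apply: pdvd_nat.
Qed.

(** Passing from j to j+1 multiplies both p / C(2(p-j),p-j) and j C(2j,j)/2 by
    factors without p in the denominator, namely 2(2p-2j-1)/(p-j) and 2(2j+1)/j,
    which agree mod p; the case j = 1 is C(2p-2,p-1) = -p mod p^2.  The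
    statement includes j > p/2, where both terms are still p-integral. *)
Lemma central_bin_reflect j : (0 < j < p)%N ->
  pdvd p 1 (p%:R / 'C(2 * (p - j), p - j)%:R + j%:R * 'C(2 * j, j)%:R / 2%:R).
Proof.
have pP : pdvd p 1 p%:R by apply: (pdvd_expp p_pr 1).
have nP n := pdvd_nat p_pr n.
have h2 : pdvd p 0 2%:R^-1 by apply: pdvd_inv_lt; lia.
have pF := prime_natr_neq0 p_pr.
elim: j => // -[_ _|j IHj /andP[_ jp]].
  have := @binprod_apery_prod p (prime_gt0 p_pr) p.-1.
  rewrite prednK ?prime_gt0 // leqnn => /(_ isT).
  rewrite /binprod binn mulr1 (_ : p.-1 + p.-1 = 2 * (p - 1))%N; last by lia.
  rewrite (_ : p.-1 = p - 1)%N; last by lia.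
  have -> : (-1) ^+ (p - 1) = 1 :> rat.
    by rewrite -signr_odd oddB ?prime_gt0 // p_odd.
  move=> ->; rewrite (_ : p + (p - 1) = 2 * p - 1)%N; last by lia.
  have [q1 q2] := pdvd_apery_prod (leqnn p).
  have q0 : apery_prod p%:R p != 0 :> rat by apply: apery_prod_neq0; rewrite ?prime_gt0.
  have p1 : (2 * p - 1)%:R != 0 :> rat by rewrite pnatr_eq0; lia.
  rewrite muln1 bin1 natrB ?natrM in p1 *; last by lia.
  have -> : p%:R / (1 * p%:R / (2 * p%:R - 1) * apery_prod p%:R p) + 1 * 2 / 2%:R =
     2%:R * (p%:R / apery_prod p%:R p)
     + (apery_prod p%:R p - 1) * (apery_prod p%:R p)^-1 :> rat.
    by field; rewrite pF p1 q0.
  apply: pdvdD => //; first by apply: pdvdMl => //; apply: pdvdMr.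
  by apply: pdvdMr => //; apply: (@pdvd_le _ 2).
have {IHj} := IHj (ltnW jp); have := ltn0Sn j; move: j.+1 jp => {}j jp j0 IHj.
have E1 := central_binS (p - j.+1); have E2 := central_binS j.
rewrite (_ : (p - j.+1).+1 = p - j)%N in E1; last by lia.
have c0 : 'C(2 * (p - j.+1), p - j.+1)%:R != 0 :> rat by rewrite pnatr_eq0 -lt0n bin_gt0; lia.
have c1 : 'C(2 * (p - j), p - j)%:R != 0 :> rat by rewrite pnatr_eq0 -lt0n bin_gt0; lia.
have jF : j%:R != 0 :> rat by rewrite pnatr_eq0 -lt0n.
have j1F : j.+1%:R != 0 :> rat by rewrite pnatr_eq0.
have pjF : (p - j)%:R != 0 :> rat by rewrite pnatr_eq0; lia.
have {}E1 : p%:R / 'C(2 * (p - j.+1), p - j.+1)%:R =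
    2%:R * (2 * (p - j.+1)).+1%:R / (p - j)%:R *
    (p%:R / 'C(2 * (p - j), p - j)%:R) :> rat.
  move: E1 => /(congr1 (fun n => n%:R : rat)); rewrite !natrM => E1.
  apply: (mulIf (mulf_neq0 pjF (mulf_neq0 c0 c1))).
  transitivity (p%:R * ((p - j)%:R * 'C(2 * (p - j), p - j)%:R) : rat); first by field.
  by rewrite E1; field; rewrite c1 pjF.
have {}E2 : j.+1%:R * 'C(2 * j.+1, j.+1)%:R / 2%:R =
    2%:R * (2 * j).+1%:R / j%:R * (j%:R * 'C(2 * j, j)%:R / 2%:R) :> rat.
  move: E2 => /(congr1 (fun n => n%:R : rat)); rewrite !natrM => ->.
  by field.
rewrite E1 E2; set v := p%:R / _ in IHj *; set u := j%:R * _ / _ in IHj *.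
(* The two growth factors differ by -2p / (j (p - j)). *)
have -> : 2%:R * (2 * (p - j.+1)).+1%:R / (p - j)%:R * v
          + 2%:R * (2 * j).+1%:R / j%:R * u =
   2%:R * (2 * (p - j.+1)).+1%:R / (p - j)%:R * (v + u)
   + 2%:R * (p%:R * (j%:R^-1 * (p - j)%:R^-1) * u).
  have EB : (p - j)%:R = p%:R - j%:R :> rat by rewrite natrB //; lia.
  have EB' : (p - j.+1)%:R = p%:R - (j%:R + 1) :> rat by rewrite natrB ?natr1 //; lia.
  move: pjF; rewrite -[(2 * (p - j.+1)).+1%:R]natr1 -[(2 * j).+1%:R]natr1.
  rewrite !natrM EB EB' => pjF.
  by field; rewrite jF pjF.
have hj : pdvd p 0 j%:R^-1 by apply: pdvd_inv_lt; lia.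
have hpj : pdvd p 0 (p - j)%:R^-1 by apply: pdvd_inv_lt; lia.
apply: pdvdD => //; first by do !apply: pdvdMl => //.
apply: pdvdMl => //; apply: pdvdMr => //; last by do !apply: pdvdMl => //.
by apply: pdvdMr => //; apply: pdvdMl.
Qed.

(** In other words p^2 does not divide C(2k,k): read it off from the reflected,
    integral, side of [central_bin_reflect]. *)
Lemma pdvd_div_central_bin k : (0 < k < p)%N -> pdvd p 0 (p%:R / 'C(2 * k, k)%:R).
Proof.
move=> kp; have := @central_bin_reflect (p - k); rewrite subKn; last by lia.
set u := (p - k)%:R * _ / _ => H.
rewrite -[X in pdvd _ _ X](addrK u); apply: pdvdB => //.
  by apply: (@pdvd_le _ 1) => //; apply: H; lia.
apply: pdvdMl => //; last by apply: pdvd_inv_lt; lia.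
by apply: pdvdMl => //; apply: pdvd_nat.
Qed.

Hypothesis p_gt5 : (5 < p)%N.

Let lhs1 : rat := p%:R * \sum_(1 <= k < p)
       (-1) ^+ (k - 1)%N / (k%:R ^+ 5 * 'C((2 * k)%N, k)%:R).
Let lhs2 : rat := \sum_(1 <= k < p) (-1) ^+ k * 'C((2 * k)%N, k)%:R / k%:R ^+ 4.
Let S : rat := \sum_(1 <= k < p) (lucas (2 * k))%:R / k%:R.
Let rhs1 : rat := 5 * (1 - (lucas p)%:R ^+ 2) / (8 * p%:R ^+ 4)
     - 5 / (4 * p%:R ^+ 3) * S
     + 3 * harmonic (p - 1) 1 / p%:R ^+ 3
     - 3 * p%:R / 5 * bernoulli (p - 5).

(** Eliminate the sum of the apery terms between [lucas_apery_sum] and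
    [koecher_harmonic]. *)
Lemma first_congruence : pdvd p 2 (lhs1 - rhs1).
Proof.
have pF := prime_natr_neq0 p_pr.
have nP n := pdvd_nat p_pr n.
rewrite /rhs1 /S lucas_apery_sum ?p_odd // subn1.
have := sum_inv_cubic p_pr p_gt5; have := koecher_harmonic (prime_gt0 p_pr).
set Z := \sum_(1 <= k < p) _; set H := harmonic _ _; set B := bernoulli _ => ZE ZB.
set T := \sum_(1 <= k < p) apery_term _ _.
pose Y := \sum_(1 <= k < p) apery_term (p%:R : rat) k * (k%:R ^+ 2 - p%:R ^+ 2)^-1.
have {}ZE : Z = - H / p%:R ^+ 2 + 5 / 2 * T + 2 * p%:R ^+ 2 * Y.
  rewrite ZE -addrA; congr (_ + _); rewrite !mulr_sumr -big_split !big_nat.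
  apply: eq_bigr => k kp /=.
  have := sqr_nat_neq kp; rewrite -subr_eq0 => h.
  by field.
have -> : lhs1 - (- 5 / (4 * p%:R) * T - 5 / (2 * p%:R ^+ 3) * H
                  + 3 * H / p%:R ^+ 3 - 3 * p%:R / 5 * B)
  = (lhs1 - p%:R * Y) + 2%:R^-1 * ((Z + 6 / 5 * (p%:R ^+ 2 * B)) / p%:R ^+ 1).
  by rewrite ZE; field.
apply: pdvdD => //; last first.
  by apply: pdvdMl => //; [apply: pdvd_inv_lt; lia | apply: pdvd_divp].
rewrite /lhs1 -mulrBr -sumrB mulr_sumr; apply: pdvd_sum_nat => // k kp.
have /andP[k0 kp'] := kp.
have kF : k%:R != 0 :> rat by rewrite pnatr_eq0 -lt0n.
have cF : 'C(2 * k, k)%:R != 0 :> rat by rewrite pnatr_eq0 -lt0n bin_gt0; lia.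
have := sqr_nat_neq kp; rewrite -subr_eq0 => h.
rewrite /apery_term subn1.
have -> : p%:R * ((-1) ^+ k.-1 / (k%:R ^+ 5 * 'C(2 * k, k)%:R) -
   (-1) ^+ k.-1 * apery_prod p%:R k / (k%:R ^+ 3 * 'C(2 * k, k)%:R)
     * (k%:R ^+ 2 - p%:R ^+ 2)^-1) =
   ((-1) ^+ k.-1 * (p%:R / 'C(2 * k, k)%:R)
     * ((k%:R ^+ 5)^-1 * (k%:R ^+ 2 - p%:R ^+ 2)^-1)) *
   - (k%:R ^+ 2 * (apery_prod p%:R k - 1) + p%:R ^+ 2) :> rat.
  move: h kF cF; move: (apery_prod _ _).
  move: ((-1) ^+ _) 'C(_, _)%:R k%:R p%:R => s c x y q h x0 c0.
  by field; rewrite h x0 c0.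
apply: pdvdMl => //.
  apply: pdvdMl => //; last first.
    by apply: pdvdMl => //; [exact: pdvd_invexp | exact: pdvd_inv_sub_sqr].
  apply: pdvdMl => //; last exact: pdvd_div_central_bin.
  by apply: pdvdX => //; exact: (pdvd_int p_pr (-1)).
apply: pdvdN; apply: pdvdD => //; last exact: pdvd_expp.
apply: pdvdMl => //; first exact: pdvdX.
by case: (pdvd_apery_prod (ltnW kp')).
Qed.

(** Substitute k -> p - k; the sign is preserved because p is odd. *)
Lemma lhs2_double_lhs1 : pdvd p 1 (lhs2 - 2 * lhs1).
Proof.
have pF := prime_natr_neq0 p_pr.
have nP n := pdvd_nat p_pr n.
have pP : pdvd p 1 p%:R by apply: (pdvd_expp p_pr 1).
rewrite /lhs1 /lhs2 big_nat_rev /= !mulr_sumr -sumrB.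
rewrite big_nat_rev /=.
apply: pdvd_sum_nat => // j jp; have /andP[j0 jp'] := jp.
rewrite add1n !subSS (_ : p - (p - j) = j)%N; last by lia.
have sE : (-1) ^+ (p - j - 1) = (-1) ^+ j :> rat.
  rewrite -signr_odd -[RHS]signr_odd -subnDA oddB ?oddD ?p_odd; last by lia.
  by case: (odd j).
rewrite sE.
have h2 : pdvd p 0 2%:R^-1 by apply: pdvd_inv_lt; lia.
have jF : j%:R != 0 :> rat by rewrite pnatr_eq0 -lt0n.
have pjF : (p - j)%:R != 0 :> rat by rewrite pnatr_eq0; lia.
have cF : 'C(2 * (p - j), p - j)%:R != 0 :> rat by rewrite pnatr_eq0 -lt0n bin_gt0; lia.
have R := central_bin_reflect jp.
set v := p%:R / _ in R; set c := 'C(2 * j, j)%:R in R *.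
have -> : (-1) ^+ j * c / j%:R ^+ 4 -
    2 * (p%:R * ((-1) ^+ j / ((p - j)%:R ^+ 5 * 'C(2 * (p - j), p - j)%:R))) =
  (-1) ^+ j * (c * j%:R * (((p - j)%:R ^+ 5)^-1 * (j%:R ^+ 5)^-1) *
     (p%:R * (p%:R ^+ 4 - 5%:R * p%:R ^+ 3 * j%:R + 10%:R * p%:R ^+ 2 * j%:R ^+ 2
        - 10%:R * p%:R * j%:R ^+ 3 + 5%:R * j%:R ^+ 4))
   - 2%:R * ((p - j)%:R ^+ 5)^-1 * (v + j%:R * c / 2%:R)) :> rat.
  rewrite /v; move: pjF; rewrite natrB ?(ltnW jp') // => pjF.
  by field; rewrite jF pjF cF.
have sP : pdvd p 0 ((-1) ^+ j) by apply: pdvdX => //; exact: (pdvd_int p_pr (-1)).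
have cP : pdvd p 0 c by apply: nP.
have i1 : pdvd p 0 ((p - j)%:R ^+ 5)^-1 by apply: pdvd_invexp => //; lia.
have i2 : pdvd p 0 (j%:R ^+ 5)^-1 by apply: pdvd_invexp.
apply: pdvdMl => //; apply: pdvdB => //; last by apply: pdvdMl => //; apply: pdvdMl.
apply: pdvdMl => //; first by do !apply: pdvdMl => //.
apply: pdvdMr => //.
by do ?[apply: pdvdD => // | apply: pdvdN | apply: pdvdX => // | apply: pdvdMl => //].
Qed.

Let rhs2 : rat := 5 * (1 - (lucas p)%:R ^+ 2) / (4 * p%:R ^+ 4)
     - 5 / (2 * p%:R ^+ 3) * S
     + 6 * harmonic (p - 1) 1 / p%:R ^+ 3.

Lemma second_congruence : pdvd p 1 (lhs2 - rhs2).
Proof.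
have nP n := pdvd_nat p_pr n.
have -> : lhs2 - rhs2 = (lhs2 - 2 * lhs1) + 2%:R * (lhs1 - rhs1)
                        - 6%:R * 5%:R^-1 * (p%:R * bernoulli (p - 5)).
  rewrite /rhs1 /rhs2; move: (prime_natr_neq0 p_pr).
  move: lhs1 lhs2 S (harmonic _ _) (bernoulli _) (lucas p)%:R p%:R => *.
  by field.
apply: pdvdB => //; last first.
  apply: pdvdMl => //; first by apply: pdvdMl => //; apply: pdvd_inv_lt.
  by apply: pdvdMr => //; [exact: (pdvd_expp p_pr 1) | apply: pdvd_bernoulli => //; lia].
apply: pdvdD => //; first exact: lhs2_double_lhs1.
by apply: pdvdMl => //; apply: (@pdvd_le _ 2) => //; apply: first_congruence.
Qed.

End Congruences.

Theorem theorem4 (p : nat) (p_prime : prime p) (p_gt5 : (5 < p)%N) :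
  let S : rat :=
    getCrat (finlog1 p (golden ^+ 2) + finlog1 p (golden ^- 2)) in
  congr_rat p 2
    (p%:R * \sum_(1 <= k < p)
       (-1) ^+ (k - 1)%N / (k%:R ^+ 5 * 'C((2 * k)%N, k)%:R))
    (5 * (1 - (lucas p)%:R ^+ 2) / (8 * p%:R ^+ 4)
     - 5 / (4 * p%:R ^+ 3) * S
     + 3 * harmonic (p - 1) 1 / p%:R ^+ 3
     - 3 * p%:R / 5 * bernoulli (p - 5))
  /\
  congr_rat p 1
    (\sum_(1 <= k < p) (-1) ^+ k * 'C((2 * k)%N, k)%:R / k%:R ^+ 4)
    (5 * (1 - (lucas p)%:R ^+ 2) / (4 * p%:R ^+ 4)
     - 5 / (2 * p%:R ^+ 3) * S
     + 6 * harmonic (p - 1) 1 / p%:R ^+ 3).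
Proof.
move=> S; rewrite /S getCrat_finlog1_golden.
have p_odd : odd p.
  by case: (even_prime p_prime) => // p2; move: p_gt5; rewrite p2.
by split; apply: congr_rat_pdvd => //;
   [apply: first_congruence | apply: second_congruence].
Qed.
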